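(* Let $E$ be an arbitrary nonempty subset of $\mathbb{R}^n$. Let $f:E\to\mathbb{R}$, $G:E\to\mathbb{R}^n$ be functions such that $$\mathrm{span}\{G(x)-G(y) : x, y\in E\}=\mathbb{R}^n.$$ Then there exists a convex function $F\in C^{1,1}_{\mathrm{loc}}(\mathbb{R}^n)$ such that $F_{|_E}=f$ and $(\nabla F)_{|_E}=G$ if and only if the following condition is satisfied. For each $y\in E$ there exists a (not necessarily convex) $C^{1,1}_{\mathrm{loc}}$ function $\varphi_y:\mathbb{R}^n\to [0, \infty)$ such that: $$\varphi_{y}(y)=0,\quad \nabla\varphi_{y}(y)=0;$$ $$M_R:=\sup\left\{\frac{|\nabla\varphi_{y}(x)-\nabla\varphi_{y}(z)|}{|x-z|} \, : x, z\in B(0, R),\ x\neq z, \ y\in E\cap B(0,R)\right\} <\infty$$ for every $R>0$, and $$f(z)+\langle G(z), x-z\rangle\leq f(y)+\langle G(y), x-y\rangle +\varphi_{y}(x)$$ for every $y, z\in E$ and every $x\in \mathbb{R}^n$. Moreover, when these conditions are satisfied, the extension $F$ can be taken to be essentially coercive, and in fact, for every number $a>0$ the formula $$F=F_a=\mathrm{conv}\left(x\mapsto \inf_{y\in E}\left\{f(y)+\langle G(y), x-y\rangle+\varphi_{y}(x)+a|x-y|^2\right\}\right)$$ defines such an essentially coercive $C^{1,1}_{\mathrm{loc}}$ convex extension of the jet $(f, G)$ to $\mathbb{R}^n$ (that is, $F_a=f$ and $\nabla F_a=G$ on $E$).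
   Context: $|\cdot|$, $\langle\cdot,\cdot\rangle$ are the Euclidean norm and inner product, $B(x,r)$ is the closed ball of center $x$ and radius $r$. $C^{1,1}_{\mathrm{loc}}(\mathbb{R}^n)$ is the class of differentiable functions whose gradient is locally Lipschitz (Lipschitz on every ball). A supremum over the empty set of nonnegative quantities is $0$. A function $F:\mathbb{R}^n\to\mathbb{R}$ is essentially coercive if there is a linear function $\ell:\mathbb{R}^n\to\mathbb{R}$ with $\lim_{|x|\to\infty}(F(x)-\ell(x))=\infty$. $\mathrm{conv}(g)(x)=\sup\{\varphi(x) : \varphi \text{ convex}, \varphi\leq g\}$ is the convex envelope of $g$. *)

(* Defs.v *)
From HB Require Import structures.
From mathcomp Require Import all_boot all_order all_algebra.
From mathcomp Require Import all_classical all_reals all_analysis.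

Set Implicit Arguments.
Unset Strict Implicit.
Unset Printing Implicit Defensive.

Import Order.TTheory GRing.Theory Num.Theory.
Import numFieldNormedType.Exports.

Local Open Scope classical_set_scope.
Local Open Scope ring_scope.

(* The library norm on ['rV[R]_n] is the sup norm, so the Euclidean structure
   is defined here. Differentiability does not depend on the choice of norm. *)
Definition inner (R : realType) (n : nat) (u v : 'rV[R]_n) : R :=
  \sum_(i < n) u ord0 i * v ord0 i.

Definition enorm (R : realType) (n : nat) (u : 'rV[R]_n) : R :=
  Num.sqrt (inner u u).

Definition eball (R : realType) (n : nat) (c : 'rV[R]_n) (r : R) :
    set 'rV[R]_n :=
  [set x | enorm (x - c) <= r].

(* Meaningful only where [F] is differentiable; every use below comes with
   differentiability of [F] on the whole space. *)
Definition grad (R : realType) (n : nat) (F : 'rV[R]_n -> R) (x : 'rV[R]_n) :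
    'rV[R]_n :=
  \row_(i < n) 'D_(delta_mx ord0 i) F x.

Definition C11_loc (R : realType) (n : nat) (F : 'rV[R]_n -> R) : Prop :=
  (forall x, differentiable F x) /\
  (forall (c : 'rV[R]_n) (r : R), exists L : R,
     forall x z, eball c r x -> eball c r z ->
       enorm (grad F x - grad F z) <= L * enorm (x - z)).

(* The library span is that of a finite sequence; [A] may be infinite. *)
Definition lspan (R : realType) (n : nat) (A : set 'rV[R]_n) : set 'rV[R]_n :=
  [set v | exists2 s : seq 'rV[R]_n,
     (forall u, u \in s -> A u) & v \in span s].

Definition essentially_coercive (R : realType) (n : nat)
    (F : 'rV[R]_n -> R) : Prop :=
  exists l : {linear 'rV[R]_n -> R^o},
    forall A : R, exists r : R, forall x, r <= enorm x -> A <= F x - l x.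

(* Envelopes are taken in [\bar R], where every supremum and infimum exists;
   [sup] and [inf] on [R] have a default value instead. *)
Definition convex_envelope (R : realType) (n : nat)
    (g : 'rV[R]_n -> \bar R) (x : 'rV[R]_n) : \bar R :=
  ereal_sup [set (phi x)%:E | phi in
    [set phi : 'rV[R]_n -> R |
       convex_function [set: 'rV[R]_n] phi /\
       forall z, ((phi z)%:E <= g z)%E]].

(* In what follows only the values of the jet [(f, G)] on [E], and only the
   functions [phi y] with [y] in [E], are relevant. *)
Definition convex_C11_loc_extension (R : realType) (n : nat)
    (E : set 'rV[R]_n) (f : 'rV[R]_n -> R) (G : 'rV[R]_n -> 'rV[R]_n)
    (F : 'rV[R]_n -> R) : Prop :=
  [/\ convex_function [set: 'rV[R]_n] F,
      C11_loc F,
      (forall y, E y -> F y = f y) &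
      (forall y, E y -> grad F y = G y)].

(* The constant M_R with [R := r]; [0] is adjoined because a supremum of nonnegative
   quantities over the empty set is [0], while [ereal_sup set0 = -oo]. *)
Definition grad_lip_sup (R : realType) (n : nat) (E : set 'rV[R]_n)
    (phi : 'rV[R]_n -> 'rV[R]_n -> R) (r : R) : \bar R :=
  ereal_sup ([set 0%E] `|`
    [set q | exists x z y,
       [/\ eball 0 r x, eball 0 r z, x <> z, (E `&` eball 0 r) y &
           q = (enorm (grad (phi y) x - grad (phi y) z) / enorm (x - z))%:E]]).

Definition majorant_condition (R : realType) (n : nat)
    (E : set 'rV[R]_n) (f : 'rV[R]_n -> R) (G : 'rV[R]_n -> 'rV[R]_n)
    (phi : 'rV[R]_n -> 'rV[R]_n -> R) : Prop :=
  [/\ (forall y, E y ->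
         [/\ C11_loc (phi y), (forall x, 0 <= phi y x),
             phi y y = 0 & grad (phi y) y = 0]),
      (forall r : R, 0 < r -> (grad_lip_sup E phi r < +oo)%E) &
      (forall y z x, E y -> E z ->
         f z + inner (G z) (x - z) <= f y + inner (G y) (x - y) + phi y x)].

Definition inf_majorant (R : realType) (n : nat)
    (E : set 'rV[R]_n) (f : 'rV[R]_n -> R) (G : 'rV[R]_n -> 'rV[R]_n)
    (phi : 'rV[R]_n -> 'rV[R]_n -> R) (a : R) (x : 'rV[R]_n) : \bar R :=
  ereal_inf
    [set (f y + inner (G y) (x - y) + phi y x + a * enorm (x - y) ^+ 2)%:E
    | y in E].

(* Main.v *)
(* Necessity: take for phi_y the gap between F and its tangent at y.
   Sufficiency: with h_y(x) = f(y) + <G(y), x-y> + phi_y(x) + a|x-y|^2, the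
   convex envelope F of inf_y h_y is the infimum of sum t_i h_(y_i)(x_i) over
   all representations of x as a convex combination of the x_i, the y_i ranging
   over E.  The tangents f(z) + <G(z), x-z> lie below every h_y, hence below F,
   and the span condition makes their supremum grow like an affine function plus
   c|x|.  So in a nearly optimal combination for a point x of a given ball, half
   of the weight sits on indices for which x_i and y_i stay in a larger ball,
   where the second differences of h_y are uniformly O(|v|^2).  Moving only those
   x_i yields F(x+u) + F(x-u) - 2F(x) <= C|u|^2 locally, which for a convex
   function means local Lipschitz continuity of the gradient. *)

Require Import Defs.
From HB Require Import structures.
From mathcomp Require Import all_boot all_order all_algebra.
From mathcomp Require Import all_classical all_reals all_analysis.
From mathcomp Require Import ring lra.

Set Implicit Arguments.
Unset Strict Implicit.
Unset Printing Implicit Defensive.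

Import Order.TTheory GRing.Theory Num.Theory.
Import numFieldNormedType.Exports.

Local Open Scope classical_set_scope.
Local Open Scope ring_scope.

(** * Euclidean inner product and norm *)

Lemma innerC (R : realType) n (u v : 'rV[R]_n) : inner u v = inner v u.
Proof. by apply: eq_bigr => i _; rewrite mulrC. Qed.

Lemma inner_is_linear (R : realType) n (u : 'rV[R]_n) :
  linear (inner u : 'rV[R]_n -> R^o).
Proof.
move=> a v w; rewrite /inner scaler_sumr -big_split; apply: eq_bigr => i _ /=.
by rewrite !mxE mulrDr mulrCA.
Qed.

HB.instance Definition _ (R : realType) n (u : 'rV[R]_n) :=
  GRing.isLinear.Build R 'rV[R]_n R^o *:%R (inner u) (inner_is_linear u).

Lemma innerDr (R : realType) n (u v w : 'rV[R]_n) :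
  inner u (v + w) = inner u v + inner u w.
Proof. exact: (linearD (inner u)). Qed.

Lemma innerBr (R : realType) n (u v w : 'rV[R]_n) :
  inner u (v - w) = inner u v - inner u w.
Proof. exact: (linearB (inner u)). Qed.

Lemma innerNr (R : realType) n (u v : 'rV[R]_n) : inner u (- v) = - inner u v.
Proof. exact: (linearN (inner u)). Qed.

Lemma innerZr (R : realType) n (u v : 'rV[R]_n) a :
  inner u (a *: v) = a * inner u v.
Proof. exact: (linearZ_LR (inner u)). Qed.

Lemma inner0r (R : realType) n (u : 'rV[R]_n) : inner u 0 = 0.
Proof. exact: (linear0 (inner u)). Qed.

Lemma innerDl (R : realType) n (u v w : 'rV[R]_n) :
  inner (v + w) u = inner v u + inner w u.
Proof. by rewrite innerC innerDr !(innerC u). Qed.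

Lemma innerBl (R : realType) n (u v w : 'rV[R]_n) :
  inner (v - w) u = inner v u - inner w u.
Proof. by rewrite innerC innerBr !(innerC u). Qed.

Lemma innerZl (R : realType) n (u v : 'rV[R]_n) a :
  inner (a *: v) u = a * inner v u.
Proof. by rewrite innerC innerZr innerC. Qed.

Lemma inner0l (R : realType) n (u : 'rV[R]_n) : inner 0 u = 0.
Proof. by rewrite innerC inner0r. Qed.

Lemma inner_delta (R : realType) n (u : 'rV[R]_n) i :
  inner u (delta_mx ord0 i) = u ord0 i.
Proof.
rewrite /inner (bigD1 i)//= big1 ?addr0 => [|j ji].
  by rewrite mxE !eqxx mulr1.
by rewrite mxE eqxx (negbTE ji) mulr0.
Qed.

Lemma inner_ge0 (R : realType) n (u : 'rV[R]_n) : 0 <= inner u u.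
Proof. by apply: sumr_ge0 => i _; rewrite -expr2 sqr_ge0. Qed.

Lemma enorm_ge0 (R : realType) n (u : 'rV[R]_n) : 0 <= enorm u.
Proof. exact: sqrtr_ge0. Qed.

Lemma enorm_sqr (R : realType) n (u : 'rV[R]_n) : enorm u ^+ 2 = inner u u.
Proof. by rewrite sqr_sqrtr// inner_ge0. Qed.

Lemma enormZ (R : realType) n (u : 'rV[R]_n) a :
  enorm (a *: u) = `|a| * enorm u.
Proof.
by rewrite /enorm innerZr innerZl mulrA -expr2 sqrtrM ?sqr_ge0// sqrtr_sqr.
Qed.

Lemma enormN (R : realType) n (u : 'rV[R]_n) : enorm (- u) = enorm u.
Proof. by rewrite -scaleN1r enormZ normrN1 mul1r. Qed.

Lemma enorm0 (R : realType) n : enorm (0 : 'rV[R]_n) = 0.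
Proof. by rewrite /enorm inner0r sqrtr0. Qed.

Lemma enormB (R : realType) n (u v : 'rV[R]_n) : enorm (u - v) = enorm (v - u).
Proof. by rewrite -enormN opprB. Qed.

Lemma enorm_eq0 (R : realType) n (u : 'rV[R]_n) : enorm u = 0 -> u = 0.
Proof.
move=> u0; have /eqP : inner u u = 0 by rewrite -enorm_sqr u0 expr0n.
rewrite psumr_eq0 => [/allP ui0|i _]; last by rewrite -expr2 sqr_ge0.
apply/rowP => i; rewrite mxE; apply/eqP.
by have := ui0 i (mem_index_enum i); rewrite mulf_eq0 orbb.
Qed.

Lemma enorm_gt0 (R : realType) n (u : 'rV[R]_n) : u != 0 -> 0 < enorm u.
Proof.
move=> u0; rewrite lt_neqAle enorm_ge0 andbT eq_sym.
by apply: contraNneq u0 => /enorm_eq0/eqP.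
Qed.

(** Expanding the square of [enorm v *: u - enorm u *: v] gives [2 |u| |v| (|u| |v| - <u, v>) >= 0];
    the factor [|u| |v|] is then cancelled. *)
Lemma cauchy_schwarz (R : realType) n (u v : 'rV[R]_n) :
  inner u v <= enorm u * enorm v.
Proof.
have [u0|un0] := eqVneq (enorm u) 0.
  by rewrite (enorm_eq0 u0) inner0l mulr_ge0// enorm_ge0.
have [v0|vn0] := eqVneq (enorm v) 0.
  by rewrite (enorm_eq0 v0) inner0r mulr_ge0// enorm_ge0.
have up : 0 < enorm u by rewrite lt_neqAle eq_sym un0 enorm_ge0.
have vp : 0 < enorm v by rewrite lt_neqAle eq_sym vn0 enorm_ge0.
have := inner_ge0 (enorm v *: u - enorm u *: v).
rewrite !(innerBl, innerBr, innerZl, innerZr) (innerC v u) -!enorm_sqr.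
have := mulr_gt0 up vp; move: (enorm u) (enorm v) (inner u v) => a b c ab h.
rewrite -(ler_pM2l ab); lra.
Qed.

Lemma enormD (R : realType) n (u v : 'rV[R]_n) :
  enorm (u + v) <= enorm u + enorm v.
Proof.
rewrite -[leRHS]ger0_norm ?addr_ge0 ?enorm_ge0// -sqrtr_sqr.
rewrite /enorm ler_wsqrtr// -!/(enorm _) innerDl !innerDr (innerC v u).
rewrite -!enorm_sqr; have := cauchy_schwarz u v; lra.
Qed.

Lemma enorm_le_sum (R : realType) n (u : 'rV[R]_n) :
  enorm u <= \sum_(i < n) `|u ord0 i|.
Proof.
have s0 : 0 <= \sum_(i < n) `|u ord0 i| by exact: sumr_ge0.
rewrite -[leRHS]ger0_norm// -sqrtr_sqr /enorm ler_wsqrtr// expr2 mulr_suml.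
apply: ler_sum => i _; apply: le_trans (ler_norm _) _; rewrite normrM.
by rewrite ler_wpM2l// (bigD1 i)//= lerDl sumr_ge0.
Qed.

(** Here [|u|] is the sup norm, in which the little-o of differentiability is expressed. *)
Lemma enorm_sqr_le (R : realType) n (u : 'rV[R]_n) :
  enorm u ^+ 2 <= n%:R * `|u| ^+ 2.
Proof.
rewrite enorm_sqr -[n in n%:R]card_ord mulr_natl -sumr_const.
apply: ler_sum => i _; rewrite -expr2 -real_normK ?num_real//.
rewrite lerXn2r// ?nnegrE//; have := @mx_normrE R 1 n u.
by rewrite -[`|u|]/(mx_norm u) => ->; apply: (le_bigmax _ _ (ord0, i)).
Qed.

Lemma enorm_segment (R : realType) n (x v : 'rV[R]_n) (r s : R) :
  -1 <= s <= 1 ->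
  enorm (x + v) <= r -> enorm (x - v) <= r -> enorm (x + s *: v) <= r.
Proof.
move=> /andP[s0 s1] h1 h2.
have -> : x + s *: v = ((1 + s) / 2) *: (x + v) + ((1 - s) / 2) *: (x - v).
  by apply/rowP => i; rewrite !mxE; field.
apply: le_trans (enormD _ _) _; rewrite !enormZ !ger0_norm; [|lra|lra].
have p1 : 0 <= (1 + s) / 2 by lra.
have p2 : 0 <= (1 - s) / 2 by lra.
have := ler_wpM2l p1 h1; have := ler_wpM2l p2 h2; lra.
Qed.

(** * Differential calculus along lines *)

Lemma inner_continuous (R : realType) n (p : 'rV[R]_n) :
  continuous (inner p : 'rV[R]_n -> R^o).
Proof.
apply: continuous_big => [|i _]; first exact: add_continuous.
move=> x; apply: (@continuous_comp _ _ _ (fun y : 'rV[R]_n => y ord0 i)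
  ( *%R (p ord0 i))); first exact: coord_continuous.
exact: mulrl_continuous.
Qed.

Lemma derive_inner_grad (R : realType) n (F : 'rV[R]_n -> R) x v :
  differentiable F x -> 'D_v F x = inner (grad F x) v.
Proof.
move=> dF; rewrite deriveE// [in LHS](row_sum_delta v) linear_sum.
apply: eq_bigr => i _; rewrite linearZ /= mxE deriveE//.
exact: mulrC.
Qed.

Lemma is_derive_line (R : realType) n (F : 'rV[R]_n -> R) x v (s : R) :
  differentiable F (x + s *: v) ->
  is_derive s 1 (fun t => F (x + t *: v)) (inner (grad F (x + s *: v)) v).
Proof.
move=> dF; have qE :
    (fun h => h^-1 *: (((fun t => F (x + t *: v)) \o shift s) (h *: 1) -
        F (x + s *: v))) =
    (fun h => h^-1 *: ((F \o shift (x + s *: v)) (h *: v) - F (x + s *: v))).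
  apply/funext => h /=; congr (_ *: (F _ - _)).
  by rewrite [_%:A]mulr1 scalerDl addrCA.
apply: DeriveDef; first by rewrite /derivable /= qE; exact: diff_derivable.
by rewrite -derive_inner_grad// /derive /= qE.
Qed.

(** The function [q t = F (x + t v) + F (x - t v) - M |v|^2 t^2] is nonincreasing on [[0, 1]]: by
    Cauchy-Schwarz and the bound on gradients at two points [2 t v] apart, its derivative is at most
    0. Comparing [q 1] with [q 0] concludes. *)
Lemma second_difference_le (R : realType) n (F : 'rV[R]_n -> R) (M : R) x v :
  (forall z, differentiable F z) ->
  (forall s, 0 <= s <= 1 ->
     enorm (grad F (x + s *: v) - grad F (x - s *: v)) <=
     M * enorm ((x + s *: v) - (x - s *: v))) ->
  F (x + v) + F (x - v) - 2 * F x <= M * enorm v ^+ 2.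
Proof.
move=> dF LF; pose q (t : R) : R := F (x + t *: v) + F (x + t *: - v) -
  M * enorm v ^+ 2 * (t ^+ 2).
pose dq (t : R) : R := inner (grad F (x + t *: v)) v + inner (grad F (x + t *: - v)) (- v)
  - M * enorm v ^+ 2 * (2 * t).
have qd (s : R) : is_derive s (1 : R) q (dq s).
  have d1 := is_derive_line (dF (x + s *: v)).
  have d2 := is_derive_line (dF (x + s *: - v)).
  have -> : q = (fun t => F (x + t *: v)) + (fun t => F (x + t *: - v)) -
      (M * enorm v ^+ 2) *: ((id : R -> R) ^+ 2).
    by apply/funext => t.
  apply: is_derive_eq; rewrite /dq; congr (_ - _).
  by rewrite -[LHS]/(_ * _) expr1 -[(_ *: 1)]/(_ * 1) mulr1 mulr_natl.
have : q 1 <= q 0.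
  apply: (@ler0_derive1_nincr _ q 0 1) => //.
  - move=> s; rewrite in_itv/= => /andP[s0 s1].
    rewrite derive1E (@derive_val _ _ _ _ _ _ _ (qd s)) /dq scalerN innerNr.
    rewrite -innerBl subr_le0.
    apply: le_trans (cauchy_schwarz _ _) _.
    have := LF s; rewrite (ltW s0) (ltW s1) => /(_ isT).
    rewrite opprD opprK addrACA subrr add0r -mulr2n -scaler_nat.
    rewrite !enormZ (ger0_norm (ltW s0)) ger0_norm// => h.
    apply: le_trans (ler_wpM2r (enorm_ge0 v) h) _.
    by rewrite le_eqVlt; apply/orP; left; apply/eqP; ring.
  - apply: derivable_within_continuous => s _; exact: (@ex_derive _ _ _ _ _ _ _ (qd s)).
rewrite /q !scale1r !scale0r !addr0 expr1n expr0n /=; lra.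
Qed.

(** A quadratic remainder is little-o of the increment, so uniqueness of the differential identifies
    it with [inner p]. *)
Lemma differentiable_of_quadratic (R : realType) n (F : 'rV[R]_n -> R) x p C d :
  0 < d ->
  (forall u, enorm u <= d ->
     `|F (x + u) - F x - inner p u| <= C * enorm u ^+ 2) ->
  differentiable F x /\ grad F x = p.
Proof.
move=> d0 FC; set l : {linear 'rV[R]_n -> R^o} := inner p.
have lc : continuous l by exact: inner_continuous.
pose F' : 'rV[R]_n -> R^o := F.
have FE : F' \o shift x = cst (F' x) + l +o_ (0 : 'rV[R]_n) id.
  apply/eqaddoP => e e0.
  have n0 : (0 : R) < n.+1%:R by rewrite ltr0n.
  have C0 : 0 < `|C| + 1 by rewrite ltr_wpDl.
  (* The first bound puts [u] in the Euclidean ball of radius [d], the second makes the remainder at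
     most [e |u|]. The factor [n.+1] instead of [n] keeps the denominators positive in dimension
     0. *)
  pose r := Num.min (d / n.+1%:R) (e / ((`|C| + 1) * n.+1%:R)).
  have r0 : 0 < r by rewrite lt_min !divr_gt0// mulr_gt0.
  apply/nbhs_ballP; exists r => //= u.
  rewrite -ball_normE /= sub0r normrN lt_min => /andP[/ltW ud /ltW ue].
  rewrite !fctE /=.
  have u1 : enorm u ^+ 2 <= n.+1%:R * `|u| ^+ 2.
    apply: le_trans (enorm_sqr_le u) _; rewrite ler_wpM2r ?exprn_ge0//.
    by rewrite ler_nat.
  have eud : enorm u <= d.
    rewrite -(ler_pXn2r (_ : 0 < 2)%N) ?nnegrE ?enorm_ge0 ?(ltW d0)//.
    apply: le_trans u1 _.
    have : (`|u| * n.+1%:R) ^+ 2 <= d ^+ 2.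
      by rewrite lerXn2r ?nnegrE ?mulr_ge0 ?(ltW d0)// -ler_pdivlMr.
    apply: le_trans; rewrite exprMn mulrC ler_wpM2l ?exprn_ge0//.
    by rewrite ler_eXnr// ler1n.
  have -> : F' (u + x) - (F' x + inner p u) = F (x + u) - F x - inner p u.
    by rewrite opprD addrA (addrC x).
  apply: le_trans (FC _ eud) _.
  apply: le_trans (_ : (`|C| + 1) * (n.+1%:R * `|u| ^+ 2) <= _).
    apply: le_trans (ler_wpM2l (ltW C0) u1); rewrite ler_wpM2r ?sqr_ge0//.
    by have := ler_norm C; lra.
  rewrite expr2 !mulrA ler_wpM2r//.
  by rewrite mulrC -ler_pdivlMr// mulr_gt0.
have dE := diff_unique lc FE.
have dF : differentiable F x.
  apply/diff_locallyP; rewrite dE; split => //.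
by split=> //; apply/rowP => i; rewrite mxE deriveE// dE /= inner_delta.
Qed.

(** * Convex functions with quadratically bounded second differences *)

Lemma convex_function_setTP (R : realType) n (F : 'rV[R]_n -> R) :
  convex_function [set: 'rV[R]_n] F <->
  forall x y t, 0 <= t <= 1 ->
    F (t *: x + (1 - t) *: y) <= t * F x + (1 - t) * F y.
Proof.
split=> [Fc x y t /andP[t0 t1]|Fc t x y _ _].
  by have := Fc (Itv01 t0 t1) x y (mem_setT _) (mem_setT _).
by apply: Fc; rewrite ge0 le1.
Qed.

Lemma affine_convex (R : realType) n (g y : 'rV[R]_n) (c : R) :
  convex_function [set: 'rV[R]_n] (fun x => c + inner g (x - y)).
Proof.
apply/convex_function_setTP => x z t _.
by rewrite !innerBr innerDr !innerZr le_eqVlt; apply/orP; left; apply/eqP; ring.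
Qed.

(** Stands in for the limit [t -> 0+]; [K] may have any sign. *)
Lemma le_of_le_add_small (R : realType) (a b K d : R) :
  0 < d -> (forall t, 0 < t <= d -> a <= b + K * t) -> a <= b.
Proof.
move=> d0 h; rewrite leNgt; apply/negP => ba.
have K0 : 0 < `|K| + 1 by rewrite ltr_wpDl.
have h0 : 0 < (a - b) / 2 / (`|K| + 1) by rewrite !divr_gt0// subr_gt0.
pose t := Num.min d ((a - b) / 2 / (`|K| + 1)).
have t0 : 0 < t by rewrite lt_min d0.
have := h t; rewrite t0 ge_min lexx => /(_ isT) {}h.
have : t * (`|K| + 1) * 2 <= a - b.
  by rewrite -ler_pdivlMr// -ler_pdivlMr// ge_min lexx orbT.
have : K * t <= `|K| * t by rewrite ler_wpM2r ?ler_norm// ltW.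
have := mulr_ge0 (normr_ge0 K) (ltW t0); lra.
Qed.

Definition slope (R : realType) n (F : 'rV[R]_n -> R) x (t : R) u : R :=
  (F (x + t *: u) - F x) / t.

(** For convex [F] the slopes are nondecreasing in [t], so this infimum is the one-sided directional
    derivative. The set is bounded below by [convex_slope_opp], so [inf] does not take its default
    value. *)
Definition dirder (R : realType) n (F : 'rV[R]_n -> R) x u : R :=
  inf [set slope F x t u | t in [set t | 0 < t]].

Section convex_gradient.
Context (R : realType) (n : nat) (F : 'rV[R]_n -> R).
Hypothesis Fc : convex_function [set: 'rV[R]_n] F.

(** By convexity the slope at any [h <= 1] is at most [F (x + u) - F x], while for small [h] it is
    within [e] of the derivative. *)
Lemma convex_above_tangent x u :
  differentiable F x -> F x + inner (grad F x) u <= F (x + u).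
Proof.
move=> dF; rewrite -lerBrDl; apply/ler_addgt0Pr => e e0.
have /cvgrPdist_lt/(_ e e0)/nbhs_ballP[d /= d0 dq] := @diff_derivable _ _ _ F x u dF.
pose h := Num.min (d / 2) 1.
have h0 : 0 < h by rewrite lt_min ltr01 divr_gt0.
have h1 : h <= 1 by rewrite ge_min lexx orbT.
have hd : h < d.
  have : h <= d / 2 by rewrite ge_min lexx.
  have := d0 : (0 < d); lra.
have := dq h; rewrite -ball_normE /= sub0r normrN gtr0_norm// => /(_ hd).
rewrite gt_eqF// => /(_ isT).
rewrite -/(derive F x u) derive_inner_grad// => /ltr_normlW.
rewrite -[_ *: _]/(_ * _) => {}dq.
suff : h^-1 * (F (h *: u + x) - F x) <= F (x + u) - F x.
  move: dq; lra.
rewrite mulrC ler_pdivrMr//.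
have /convex_function_setTP/(_ (x + u) x h) := Fc; rewrite (ltW h0) h1.
move/(_ isT); rewrite scalerDr addrAC -scalerDl (addrC h) subrK scale1r.
by rewrite (addrC x (h *: u)); lra.
Qed.

(** The point [x] is the combination of [x + t u] and [x - s u] with weights [s / (s + t)] and
    [t / (s + t)]. *)
Lemma convex_slope_opp x t s u : 0 < t -> 0 < s -> - slope F x s (- u) <= slope F x t u.
Proof.
move=> t0 s0; have st : 0 < s + t by exact: addr_gt0.
have /convex_function_setTP/(_ (x + t *: u) (x + s *: - u) (s / (s + t))) := Fc.
have -> : 0 <= s / (s + t) <= 1.
  by rewrite divr_ge0 ?(ltW s0) ?(ltW st)//= ler_pdivrMr// mul1r lerDl ltW.
have -> : 1 - s / (s + t) = t / (s + t) by field; rewrite gt_eqF.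
have -> : s / (s + t) *: (x + t *: u) + t / (s + t) *: (x + s *: - u) = x.
  rewrite !scalerDr addrACA -scalerDl !scalerA -mulrDl divff ?gt_eqF// scale1r.
  rewrite scalerN (mulrAC t) (mulrC t) mulrAC subrr addr0//.
move=> /(_ isT) /(ler_wpM2l (ltW st)).
set A := F (x + t *: u); set B := F (x + s *: - u).
have -> : (s + t) * (s / (s + t) * A + t / (s + t) * B) = s * A + t * B.
  by field; rewrite gt_eqF.
rewrite -subr_ge0 => h; rewrite -subr_ge0 opprK /slope -/A -/B.
have -> : (A - F x) / t + (B - F x) / s =
    (s * A + t * B - (s + t) * F x) / (s * t).
  by field; rewrite !gt_eqF.
by apply: divr_ge0 => //; rewrite mulr_ge0// ltW.
Qed.

Lemma dirder_le x t u : 0 < t -> dirder F x u <= slope F x t u.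
Proof.
move=> t0; apply: ge_inf; last by exists t.
exists (- slope F x 1 (- u)) => _ [s s0 <-].
exact: convex_slope_opp.
Qed.

Lemma dirder_ge x s u : 0 < s -> - slope F x s (- u) <= dirder F x u.
Proof.
move=> s0; apply: lb_le_inf; first by exists (slope F x 1 u); exists 1 => /=.
by move=> _ [t t0 <-]; exact: convex_slope_opp.
Qed.

Context (x : 'rV[R]_n) (C d : R).
Hypothesis d_gt0 : 0 < d.
Hypothesis F_semiconcave :
  forall u, enorm u <= d -> F (x + u) + F (x - u) - 2 * F x <= C * enorm u ^+ 2.

Lemma slope_le_opp t u : 0 < t -> t * enorm u <= d ->
  slope F x t u <= - slope F x t (- u) + C * enorm u ^+ 2 * t.
Proof.
move=> t0 tu; have := F_semiconcave (u := t *: u).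
rewrite enormZ gtr0_norm// => /(_ tu) h; rewrite -(ler_pM2r t0).
have : slope F x t u * t = F (x + t *: u) - F x by rewrite divfK ?gt_eqF.
have : slope F x t (- u) * t = F (x - t *: u) - F x.
  by rewrite -scalerN divfK ?gt_eqF.
by lra.
Qed.

Lemma slope_le_dirder t u : 0 < t -> t * enorm u <= d ->
  slope F x t u <= dirder F x u + C * enorm u ^+ 2 * t.
Proof.
move=> t0 tu; have := slope_le_opp t0 tu; have := dirder_ge x u t0; lra.
Qed.

(** Range of scales at which semiconcavity applies; [e + 1] in place of [e] allows zero
    directions. *)
Let small_scale t k (e : R) : 0 <= e -> 0 < k -> 0 < t <= d / k / (e + 1) ->
  t * k * e <= d.
Proof.
move=> e0 k0 /andP[t0]; rewrite ler_pdivlMr ?ltr_wpDl// ler_pdivlMr//.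
by apply: le_trans; rewrite mulrAC ler_wpM2r ?(ltW k0)// ler_wpM2l ?(ltW t0)// lerDl.
Qed.

(** Convexity gives one inequality; for the other, semiconcavity makes the slopes in opposite
    directions cancel up to [O(t)]. *)
Lemma dirderN u : dirder F x (- u) = - dirder F x u.
Proof.
apply/eqP; rewrite eq_le; apply/andP; split; last first.
  apply: lb_le_inf; first by exists (slope F x 1 (- u)); exists 1 => /=.
  by move=> _ [s s0 <-]; have := dirder_ge x u s0; lra.
rewrite lerNr; apply: (@le_of_le_add_small _ _ _ (C * enorm u ^+ 2)
  (d / 1 / (enorm u + 1))).
  by rewrite !divr_gt0// ltr_wpDl// enorm_ge0.
move=> t tu; have t0 : 0 < t by case/andP: tu.
have := small_scale (enorm_ge0 u) ltr01 tu; rewrite mulr1 => /(slope_le_opp t0).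
by have := dirder_le x (- u) t0; have := dirder_le x u t0; lra.
Qed.

(** Since [x + t (u + v)] is the midpoint of [x + 2 t u] and [x + 2 t v], its slope at [t] is at
    most the sum of the slopes at [2 t], which are within [O(t)] of the directional derivatives. *)
Lemma dirderD_le u v : dirder F x (u + v) <= dirder F x u + dirder F x v.
Proof.
have e0 := addr_ge0 (enorm_ge0 u) (enorm_ge0 v).
apply: (@le_of_le_add_small _ _ _ (2 * C * (enorm u ^+ 2 + enorm v ^+ 2))
  (d / 2 / (enorm u + enorm v + 1))).
  by rewrite !divr_gt0// ltr_wpDl.
move=> t tuv; have t0 : 0 < t by case/andP: tuv.
have t20 : 0 < t * 2 by rewrite mulr_gt0.
have h := small_scale e0 (ltr0n _ 2) tuv.
have tu : t * 2 * enorm u <= d.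
  by apply: le_trans h; rewrite ler_pM2l// lerDl enorm_ge0.
have tv : t * 2 * enorm v <= d.
  by apply: le_trans h; rewrite ler_pM2l// lerDr enorm_ge0.
have := slope_le_dirder t20 tu; have := slope_le_dirder t20 tv.
suff : slope F x t (u + v) <= slope F x (t * 2) u + slope F x (t * 2) v.
  by have := dirder_le x (u + v) t0; lra.
have /convex_function_setTP/(_ (x + (t * 2) *: u) (x + (t * 2) *: v) 2^-1) := Fc.
have half01 : (0 <= 2^-1 :> R) && (2^-1 <= 1 :> R).
  by rewrite invr_ge0 ler0n /=; lra.
rewrite half01.
have -> : 1 - 2^-1 = 2^-1 :> R by field.
have -> : 2^-1 *: (x + (t * 2) *: u) + 2^-1 *: (x + (t * 2) *: v) =
    x + t *: (u + v).
  by apply/rowP => i; rewrite !mxE; field.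
move=> /(_ isT) {}h; rewrite /slope -mulrDl ler_pdivrMr//.
set A := F (x + (t * 2) *: u) in h *; set B := F (x + (t * 2) *: v) in h *.
have -> : (A - F x + (B - F x)) / (t * 2) * t = (A - F x + (B - F x)) / 2.
  by field; rewrite gt_eqF.
lra.
Qed.

Lemma dirderD u v : dirder F x (u + v) = dirder F x u + dirder F x v.
Proof.
apply/eqP; rewrite eq_le dirderD_le /=.
by have := dirderD_le (u + v) (- v); rewrite addrK dirderN; lra.
Qed.

Lemma dirder0 : dirder F x 0 = 0.
Proof. by have := dirderD 0 0; rewrite addr0; lra. Qed.

(** Rescaling the parameter: the slope along [s u] at [t / s] is [s] times the slope along [u] at
    [t]. *)
Let dirderZ_le s u : 0 < s -> dirder F x (s *: u) <= s * dirder F x u.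
Proof.
move=> s0; rewrite mulrC -ler_pdivrMr//; apply: lb_le_inf.
  by exists (slope F x 1 u); exists 1 => /=.
move=> _ [t t0 <-]; rewrite ler_pdivrMr//.
have := dirder_le x (s *: u) (divr_gt0 t0 s0); rewrite /slope scalerA.
rewrite divfK ?gt_eqF//; congr (_ <= _); field.
by rewrite !gt_eqF.
Qed.

Lemma dirderZ s u : dirder F x (s *: u) = s * dirder F x u.
Proof.
have pos r w : 0 < r -> dirder F x (r *: w) = r * dirder F x w.
  move=> r0; apply/eqP; rewrite eq_le dirderZ_le//=.
  have rV : 0 < r^-1 by rewrite invr_gt0.
  have := dirderZ_le (r *: w) rV.
  by rewrite scalerA mulVf ?gt_eqF// scale1r mulrC ler_pdivlMr// mulrC.
have [s0|s0|->] := ltgtP s 0; last 1 first.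
- by rewrite scale0r mul0r dirder0.
- rewrite -[s in LHS]opprK scaleNr dirderN pos ?oppr_gt0//.
  by rewrite mulNr opprK.
- exact: pos.
Qed.

(** The directional derivative is linear, hence of the form [inner p], and it bounds [F] from below.
    Using this lower bound at [- u] in the semiconcavity inequality yields the quadratic upper bound
    at [u]. *)
Lemma convex_semiconcave_differentiable :
  differentiable F x /\
  forall u, enorm u <= d ->
    F (x + u) <= F x + inner (grad F x) u + C * enorm u ^+ 2.
Proof.
pose p : 'rV[R]_n := \row_i dirder F x (delta_mx ord0 i).
have pE u : inner p u = dirder F x u.
  rewrite [in RHS](row_sum_delta u).
  rewrite (big_morph (dirder F x) dirderD dirder0); apply: eq_bigr => i _.
  by rewrite dirderZ mxE mulrC.
have Fge u : F x + inner p u <= F (x + u).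
  have := dirder_le x u ltr01; rewrite pE /slope scale1r divr1; lra.
have Fle u : enorm u <= d -> F (x + u) <= F x + inner p u + C * enorm u ^+ 2.
  by move/F_semiconcave; have := Fge (- u); rewrite innerNr; lra.
have [] := @differentiable_of_quadratic R n F x p C d d_gt0.
  move=> u ud; have := Fge u; have := Fle u ud => h1 h2.
  by rewrite ger0_norm; lra.
by move=> dF gF; split=> // u ud; rewrite gF; exact: Fle.
Qed.

End convex_gradient.

(** The tangent at [x] is tested at [z + w], where [w] has length [|x - z|] and the direction of
    [g = grad F x - grad F z]. Together with the quadratic upper bounds from [x] to [z] and from [z]
    to [z + w] this gives [<g, w> <= 2 C |x - z|^2], where [<g, w> = |x - z| |g|]. *)
Lemma convex_semiconcave_C11_loc (R : realType) n (F : 'rV[R]_n -> R) :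
  convex_function [set: 'rV[R]_n] F ->
  (forall r, 0 < r -> exists C, forall x u, enorm x <= r -> enorm u <= r ->
    F (x + u) + F (x - u) - 2 * F x <= C * enorm u ^+ 2) ->
  C11_loc F.
Proof.
move=> Fc FC.
have dF x : differentiable F x.
  have r0 : 0 < enorm x + 1 by rewrite ltr_wpDl// enorm_ge0.
  have [C hC] := FC _ r0.
  have [] // := @convex_semiconcave_differentiable R n F Fc x C _ r0.
  by move=> u; apply: hC; rewrite lerDl.
(* Points of the ball have norm at most [s / 2], so that their differences have norm at most [s]. *)
split=> // c r; pose s := (enorm c + `|r| + 1) * 2.
have s0 : 0 < s by rewrite mulr_gt0// ltr_wpDl// addr_ge0// enorm_ge0.
have [C hC] := FC _ s0.
have upper x u : enorm x <= s -> enorm u <= s ->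
    F (x + u) <= F x + inner (grad F x) u + C * enorm u ^+ 2.
  move=> xs; have [_] := @convex_semiconcave_differentiable R n F Fc x C _ s0
    (fun u => hC x u xs); exact.
have ball x : eball c r x -> enorm x <= s / 2.
  rewrite /eball /= => xc; rewrite -[x](subrK c); apply: le_trans (enormD _ _) _.
  have := ler_norm r; have := enorm_ge0 c; rewrite /s; lra.
clearbody s; exists (2 * `|C|) => x z /ball xs /ball zs.
have [->|xz] := eqVneq x z; first by rewrite !subrr !enorm0 mulr0.
set g := grad F x - grad F z.
have [->|g0] := eqVneq g 0; first by rewrite enorm0 !mulr_ge0// enorm_ge0.
have {}g0 := enorm_gt0 g0.
have {}xz : 0 < enorm (x - z) by apply: enorm_gt0; rewrite subr_eq0.
set e := enorm (x - z) in xz *; set w := (e / enorm g) *: g.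
have we : enorm w = e.
  by rewrite enormZ ger0_norm ?divr_ge0 ?ltW// divfK ?gt_eqF.
have es : e <= s.
  by apply: le_trans (enormD _ _) _; rewrite enormN; lra.
have zE : x + (z - x) = z by rewrite addrC subrK.
have := upper z w; rewrite we => /(_ _ es) h1.
have := upper x (z - x); rewrite zE enormB -/e => /(_ _ es) h2.
have := convex_above_tangent Fc (z - x + w) (dF x).
rewrite addrA zE innerDr => h3.
have h4 : inner g w = e * enorm g.
  by rewrite innerZr -enorm_sqr; field; rewrite gt_eqF.
move: h4; rewrite innerBl => h4.
rewrite -(ler_pM2l xz).
have : C * e ^+ 2 <= `|C| * e ^+ 2 by rewrite ler_wpM2r ?sqr_ge0// ler_norm.
have xs' : enorm x <= s by lra.
have zs' : enorm z <= s by lra.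
by move: (h1 zs') (h2 xs'); lra.
Qed.

(** * Necessity *)

Lemma grad_sub_affine (R : realType) n (F : 'rV[R]_n -> R) (p y x : 'rV[R]_n) c :
  differentiable F x ->
  differentiable (fun z => F z - c - inner p (z - y)) x /\
  grad (fun z => F z - c - inner p (z - y)) x = grad F x - p.
Proof.
move=> dF; set l : {linear 'rV[R]_n -> R^o} := inner p.
have lc : continuous l by exact: inner_continuous.
have dl : differentiable l x by exact: linear_differentiable.
pose F' : 'rV[R]_n -> R^o := F; pose l' : 'rV[R]_n -> R^o := l; pose k : R^o := inner p y - c.
have -> : (fun z => F z - c - inner p (z - y)) = (F' - l' + cst k).
  apply/funext => z; rewrite innerBr -[RHS]/(F z - inner p z + (inner p y - c)).
  by ring.
have dFl : differentiable (F' - l') x by exact: differentiableB.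
have dk : differentiable (cst k : 'rV[R]_n -> R^o) x by exact: differentiable_cst.
split; first exact: differentiableD.
apply/rowP => i; rewrite !mxE deriveD; [|exact: diff_derivable..].
rewrite deriveB; [|exact: diff_derivable..].
rewrite derive_cst addr0; congr (_ - _).
by rewrite deriveE// diff_lin// /l/= inner_delta.
Qed.

(** Subtracting an affine function leaves gradient differences unchanged, so a Lipschitz constant of
    [grad F] on a ball serves for all [y] at once. The other conditions say that tangents of [F] lie
    below [F]. *)
Lemma extension_majorant (R : realType) (n : nat) (E : set 'rV[R]_n)
    (f : 'rV[R]_n -> R) (G : 'rV[R]_n -> 'rV[R]_n) (F : 'rV[R]_n -> R) :
  convex_C11_loc_extension E f G F ->
  majorant_condition E f G
    (fun y x => F x - F y - inner (grad F y) (x - y)).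
Proof.
move=> [Fc [dF lipF] Ff FG].
have gE y x := proj2 (grad_sub_affine (grad F y) y (F y) (dF x)).
have dE y x := proj1 (grad_sub_affine (grad F y) y (F y) (dF x)).
have subE (a b c : 'rV[R]_n) : a - c - (b - c) = a - b.
  by apply/rowP => i; rewrite !mxE; ring.
split.
- move=> y _; split.
  + split=> [|c r]; first exact: dE.
    have [L hL] := lipF c r; exists L => x z xc zc.
    by rewrite !gE subE; exact: hL.
  + move=> x; have := convex_above_tangent Fc (x - y) (dF y).
    by rewrite (addrC y) subrK; lra.
  + by rewrite !subrr inner0r subrr.
  + by rewrite gE subrr.
- move=> r r0; have [L hL] := lipF 0 r.
  (* [L] has no prescribed sign, and the adjoined value 0 must be bounded too. *)
  apply: (@le_lt_trans _ _ (Num.max 0 L)%:E); last exact: ltry.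
  apply: ge_ereal_sup => _ [->|[x [z [y [xr zr xz Ey ->]]]]].
    by rewrite lee_fin le_max lexx.
  rewrite lee_fin le_max; apply/orP; right.
  rewrite !gE subE ler_pdivrMr; first exact: hL.
  by apply: enorm_gt0; rewrite subr_eq0; apply/eqP.
- move=> y z x Ey Ez; rewrite -!Ff// -!FG//.
  have := convex_above_tangent Fc (x - z) (dF z).
  by rewrite (addrC z) subrK; lra.
Qed.

(** For sufficiency: a finite supremum becomes one real Lipschitz constant for all [y]. The adjoined
    0 excludes the value [-oo]. *)
Lemma grad_lip_bound (R : realType) (n : nat) (E : set 'rV[R]_n)
    (phi : 'rV[R]_n -> 'rV[R]_n -> R) (r : R) :
  (grad_lip_sup E phi r < +oo)%E ->
  exists2 M, 0 <= M & forall y x z,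
    E y -> enorm y <= r -> enorm x <= r -> enorm z <= r ->
    enorm (grad (phi y) x - grad (phi y) z) <= M * enorm (x - z).
Proof.
move=> Soo; set S := grad_lip_sup E phi r in Soo.
have S0 : (0 <= S)%E by apply: ereal_sup_ubound; left.
have SE : S = (fine S)%:E by rewrite fineK// ge0_fin_numE.
exists (fine S); first exact: fine_ge0.
move=> y x z Ey yr xr zr; have [->|xz] := eqVneq x z.
  by rewrite !subrr !enorm0 mulr0.
rewrite -ler_pdivrMr; last by apply: enorm_gt0; rewrite subr_eq0.
rewrite -lee_fin -SE; apply: ereal_sup_ubound; right.
by exists x, z, y; split; rewrite /eball /= ?subr0//; apply/eqP.
Qed.

(** * Coercivity from the span condition *)

(** Domination of [N] by the oscillation of [z |-> <G z, x>] over a finite part of [E], uniformly in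
    [x]. Being stable under sums and nonnegative multiples, the property passes from the differences
    of [G] to their span. *)
Definition osc_bounds (R : realType) n (E : set 'rV[R]_n)
    (G : 'rV[R]_n -> 'rV[R]_n) (N : 'rV[R]_n -> R) : Prop :=
  exists (Z : seq 'rV[R]_n) B, [/\ (forall z, z \in Z -> E z), 0 <= B & forall x,
    exists z z', [/\ z \in Z, z' \in Z & N x <= B * inner (G z - G z') x]].

Section osc_bounds_theory.
Context (R : realType) (n : nat) (E : set 'rV[R]_n) (G : 'rV[R]_n -> 'rV[R]_n).
Hypothesis E0 : E !=set0.

Lemma osc_bounds_le N N' :
  (forall x, N x <= N' x) -> osc_bounds E G N' -> osc_bounds E G N.
Proof.
move=> NN' [Z [B [ZE B0 h]]]; exists Z, B; split=> // x.
have [z [z' [zZ z'Z hx]]] := h x.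
by exists z, z'; split=> //; exact: le_trans hx.
Qed.

Lemma osc_bounds0 : osc_bounds E G (fun=> 0).
Proof.
have [y Ey] := E0; exists [:: y], 0; split=> // [z|x].
  by rewrite inE => /eqP->.
by exists y, y; rewrite mem_head mul0r.
Qed.

(** At each [x], whichever of the two pairs has the larger oscillation serves for both functions. *)
Lemma osc_boundsD N N' : osc_bounds E G N -> osc_bounds E G N' ->
  osc_bounds E G (fun x => N x + N' x).
Proof.
move=> [Z [B [ZE B0 h]]] [Z' [B' [ZE' B0' h']]].
exists (Z ++ Z'), (B + B'); split=> [z||x].
- by rewrite mem_cat => /orP[/ZE|/ZE'].
- exact: addr_ge0.
- have [z1 [z1' [z1Z z1'Z h1]]] := h x.
  have [z2 [z2' [z2Z z2'Z h2]]] := h' x.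
  have [le12|/ltW le21] := leP (inner (G z1 - G z1') x) (inner (G z2 - G z2') x).
    exists z2, z2'; rewrite !mem_cat z2Z z2'Z !orbT; split=> //.
    have := ler_wpM2l B0 le12; lra.
  exists z1, z1'; rewrite !mem_cat z1Z z1'Z; split=> //.
  have := ler_wpM2l B0' le21; lra.
Qed.

Lemma osc_boundsZ N c : 0 <= c -> osc_bounds E G N ->
  osc_bounds E G (fun x => c * N x).
Proof.
move=> c0 [Z [B [ZE B0 h]]]; exists Z, (c * B); split=> //; first exact: mulr_ge0.
move=> x; have [z [z' [zZ z'Z hx]]] := h x.
by exists z, z'; split=> //; rewrite -mulrA ler_wpM2l.
Qed.

Lemma osc_bounds_sum I (r : seq I) N : (forall i, osc_bounds E G (N i)) ->
  osc_bounds E G (fun x => \sum_(i <- r) N i x).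
Proof.
move=> h; elim: r => [|i r IH].
  by apply: osc_bounds_le osc_bounds0 => x; rewrite big_nil.
by apply: osc_bounds_le (osc_boundsD (h i) IH) => x; rewrite big_cons.
Qed.

Lemma osc_bounds_diff a b : E a -> E b ->
  osc_bounds E G (fun x => `|inner (G a - G b) x|).
Proof.
move=> Ea Eb; exists [:: a; b], 1; split=> // [z|x].
  by rewrite !inE => /orP[]/eqP->.
have [h|h] := leP 0 (inner (G a - G b) x).
  by exists a, b; rewrite !inE !eqxx orbT; split=> //; rewrite mul1r ger0_norm.
exists b, a; rewrite !inE !eqxx orbT; split=> //.
by rewrite mul1r ltr0_norm// !innerBl opprB.
Qed.

Lemma osc_bounds_lspan v :
  lspan [set v | exists x y, [/\ E x, E y & v = G x - G y]] v ->
  osc_bounds E G (fun x => `|inner v x|).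
Proof.
move=> [s sE vs]; have -> := @coord_span _ _ _ (in_tuple s) v vs.
have h i : osc_bounds E G (fun x =>
    `|coord (in_tuple s) i v| * `|inner (in_tuple s)`_i x|).
  apply: osc_boundsZ => //.
  have [a [b [Ea Eb ->]]] := sE (in_tuple s)`_i (mem_nth _ (ltn_ord i)).
  exact: osc_bounds_diff.
apply: osc_bounds_le (osc_bounds_sum (index_enum _) h) => x.
rewrite innerC linear_sum; apply: le_trans (ler_norm_sum _ _ _) _.
by apply: ler_sum => i _ /=; rewrite [inner x _]innerZr normrM innerC.
Qed.

Lemma osc_bounds_enorm :
  lspan [set v | exists x y, [/\ E x, E y & v = G x - G y]] = setT ->
  osc_bounds E G (fun x => enorm x).
Proof.
move=> spanE; have h (i : 'I_n) :
    osc_bounds E G (fun x => `|inner (delta_mx ord0 i) x|).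
  by apply: osc_bounds_lspan; rewrite spanE.
apply: osc_bounds_le (osc_bounds_sum (index_enum _) h) => x.
apply: le_trans (enorm_le_sum x) _; apply: ler_sum => i _.
by rewrite innerC inner_delta.
Qed.

End osc_bounds_theory.

Lemma seq_argmax (R : realType) (T : eqType) (h : T -> R) (s : seq T) x :
  x \in s -> exists2 y, y \in s & forall z, z \in s -> h z <= h y.
Proof.
elim: s x => // a [|b s] IH x _.
  by exists a; rewrite ?mem_head// => z; rewrite inE => /eqP->.
have [y ys yM] := IH b (mem_head _ _).
have [ay|/ltW ya] := leP (h a) (h y).
  exists y; first by rewrite inE ys orbT.
  by move=> z; rewrite inE => /orP[/eqP->//|/yM].
exists a; first exact: mem_head.
by move=> z; rewrite inE => /orP[/eqP->//|/yM/le_trans]; exact.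
Qed.

(** Take for [p] the mean of [G] over the finite set [Z], and at each [x] a [y] in [Z] maximizing
    [<G y, x>]. This maximum exceeds the mean by at least the oscillation divided by the size of
    [Z], hence by a multiple of [|x|]. *)
Lemma tangents_coercive (R : realType) (n : nat) (E : set 'rV[R]_n)
    (f : 'rV[R]_n -> R) (G : 'rV[R]_n -> 'rV[R]_n) :
  E !=set0 ->
  lspan [set v | exists x y, [/\ E x, E y & v = G x - G y]] = setT ->
  exists p c C, 0 < c /\ forall x, exists2 z, E z &
    inner p x + c * enorm x - C <= f z + inner (G z) (x - z).
Proof.
move=> E0 spanE; have [Z [B [ZE B0 h]]] := osc_bounds_enorm E0 spanE.
pose N : R := (size Z)%:R; have N0 : 0 < N.
  by rewrite ltr0n; have [z [z' [zZ _ _]]] := h 0; case: (Z) zZ.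
have B1 : 0 < B + 1 by rewrite ltr_wpDl.
(* [B] may vanish, hence [B + 1]. The last witness dominates the constant terms of all tangents at
   points of [Z]. *)
exists (N^-1 *: \sum_(z <- Z) G z), (N^-1 / (B + 1)),
  (\sum_(z <- Z) `|f z - inner (G z) z|).
split; first by rewrite divr_gt0// invr_gt0.
move=> x; have [z [z' [zZ z'Z hx]]] := h x.
have [y yZ yM] := seq_argmax (fun w => inner (G w) x) zZ.
exists y; first exact: ZE.
have fy : - \sum_(z <- Z) `|f z - inner (G z) z| <= f y - inner (G y) y.
  rewrite lerNl; apply: le_trans (ler_norm _) _; rewrite normrN.
  by rewrite (big_rem y)//= lerDl sumr_ge0.
have gap : inner (G y) x - inner (G z') x <=
    \sum_(w <- Z) (inner (G y) x - inner (G w) x).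
  rewrite (big_rem z')//= lerDl big_seq_cond sumr_ge0// => w.
  by rewrite andbT => /mem_rem/yM; rewrite subr_ge0.
move: gap; rewrite sumrB big_const_seq count_predT iter_addr_0 -[_ *+ _]mulr_natl.
rewrite -/N => gap.
have Bx : enorm x / (B + 1) <= inner (G y) x - inner (G z') x.
  rewrite ler_pdivrMr// mulrC; apply: le_trans hx _; rewrite innerBl.
  have := yM _ zZ; have := yM _ z'Z => h1 h2.
  apply: le_trans (_ : B * (inner (G y) x - inner (G z') x) <= _).
    by rewrite ler_wpM2l// lerB.
  by rewrite ler_wpM2r ?subr_ge0// lerDl.
have NGx : inner (N^-1 *: \sum_(w <- Z) G w) x + N^-1 / (B + 1) * enorm x <=
    inner (G y) x.
  rewrite -(ler_pM2l N0) innerZl.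
  set S := inner _ _.
  have -> : N * (N^-1 * S + N^-1 / (B + 1) * enorm x) = S + enorm x / (B + 1).
    by field; rewrite !gt_eqF.
  rewrite {}/S.
  have -> : inner (\sum_(w <- Z) G w) x = \sum_(w <- Z) inner (G w) x.
    by rewrite innerC linear_sum; apply: eq_bigr => w _; exact: innerC.
  lra.
rewrite innerBr; lra.
Qed.

(** * Convex envelopes through finite convex combinations *)

(** Induction on [s] with a running point [x] of weight [w], into which the head of the list is
    merged by two-point convexity. If both weights vanish there is no merged point, and the head is
    dropped. *)
Lemma jensen (R : realType) n (F : 'rV[R]_n -> R) (I : eqType) (s : seq I)
    (t : I -> R) (p : I -> 'rV[R]_n) :
  convex_function [set: 'rV[R]_n] F ->
  (forall i, i \in s -> 0 <= t i) -> \sum_(i <- s) t i = 1 ->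
  F (\sum_(i <- s) t i *: p i) <= \sum_(i <- s) t i * F (p i).
Proof.
move=> /convex_function_setTP Fc t0 t1.
suff gen w x : 0 <= w -> w + \sum_(i <- s) t i = 1 ->
    F (w *: x + \sum_(i <- s) t i *: p i) <= w * F x + \sum_(i <- s) t i * F (p i).
  have := gen 0 0 (lexx 0); rewrite scale0r mul0r !add0r; exact.
elim: s t0 w x {t1} => [|i s IH] t0 w x w0.
  by rewrite !big_nil !addr0 => ->; rewrite scale1r mul1r.
rewrite !big_cons !addrA => w1; have ti : 0 <= t i by exact/t0/mem_head.
have {}IH := IH (fun j js => t0 j (mem_behead (s := i :: s) js)).
have [/eqP|wt0] := eqVneq (w + t i) 0.
  rewrite paddr_eq0// => /andP[/eqP wE /eqP tE].
  have := IH 0 x (lexx 0); rewrite wE tE !(scale0r, mul0r, add0r); apply.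
  by rewrite -w1 wE tE !add0r.
have wt : 0 < w + t i by rewrite lt_neqAle eq_sym wt0 addr_ge0.
pose y := (w / (w + t i)) *: x + (t i / (w + t i)) *: p i.
have yE : (w + t i) *: y = w *: x + t i *: p i.
  by rewrite scalerDr !scalerA !(mulrC (w + t i)) !divfK.
rewrite -yE; apply: le_trans (IH _ _ (ltW wt) w1) _.
rewrite lerD2r -ler_pdivlMl//.
have := Fc x (p i) (w / (w + t i)).
have -> : 1 - w / (w + t i) = t i / (w + t i) by field.
rewrite divr_ge0 ?(ltW wt)//= ler_pdivrMr// mul1r lerDl ti => /(_ isT).
rewrite -/y => h; apply: le_trans h _.
by rewrite le_eqVlt; apply/orP; left; apply/eqP; field.
Qed.

(** An entry [(t, (p, y))] is a weight, a point and the index of the function [h y] evaluated at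
    that point. *)
Definition convex_comb (R : realType) n (E : set 'rV[R]_n) (x : 'rV[R]_n)
    (s : seq (R * ('rV[R]_n * 'rV[R]_n))) : Prop :=
  [/\ (forall i, i \in s -> 0 <= i.1 /\ E i.2.2),
      \sum_(i <- s) i.1 = 1 & \sum_(i <- s) i.1 *: i.2.1 = x].

Definition comb_value (R : realType) n (h : 'rV[R]_n -> 'rV[R]_n -> R)
    (s : seq (R * ('rV[R]_n * 'rV[R]_n))) : R :=
  \sum_(i <- s) i.1 * h i.2.2 i.2.1.

(** The number of points is unrestricted. The real [inf] is genuine once [E] is nonempty and a
    convex minorant [m] of all [h y] is given, as assumed below. *)
Definition comb_envelope (R : realType) n (E : set 'rV[R]_n)
    (h : 'rV[R]_n -> 'rV[R]_n -> R) (x : 'rV[R]_n) : R :=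
  inf [set comb_value h s | s in convex_comb E x].

Section comb_envelope_theory.
Context (R : realType) (n : nat) (E : set 'rV[R]_n)
  (h : 'rV[R]_n -> 'rV[R]_n -> R).

Lemma convex_comb1 x y : E y -> convex_comb E x [:: (1, (x, y))].
Proof.
move=> Ey; split=> [i||]; rewrite ?big_seq1 ?scale1r//.
by rewrite inE => /eqP->.
Qed.

Lemma minorant_le_comb_value (m : 'rV[R]_n -> R) x s :
  convex_function [set: 'rV[R]_n] m -> (forall y z, E y -> m z <= h y z) ->
  convex_comb E x s -> m x <= comb_value h s.
Proof.
move=> mc mh [s0 s1 <-].
apply: le_trans (jensen _ mc (fun i si => proj1 (s0 i si)) s1) _.
rewrite /comb_value big_seq [leRHS]big_seq; apply: ler_sum => i /s0[i0 Ei].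
by rewrite ler_wpM2l// mh.
Qed.

Hypothesis E0 : E !=set0.
Context (m : 'rV[R]_n -> R).
Hypothesis m_convex : convex_function [set: 'rV[R]_n] m.
Hypothesis m_le : forall y z, E y -> m z <= h y z.

Lemma comb_envelope_le x s :
  convex_comb E x s -> comb_envelope E h x <= comb_value h s.
Proof.
move=> xs; apply: ge_inf; last by exists s.
exists (m x) => _ [s' xs' <-]; exact: minorant_le_comb_value m_convex m_le xs'.
Qed.

Lemma comb_envelope_le_at x y : E y -> comb_envelope E h x <= h y x.
Proof.
move=> Ey; apply: le_trans (comb_envelope_le (convex_comb1 x Ey)) _.
by rewrite /comb_value big_seq1 mul1r.
Qed.

Lemma comb_envelope_ge (m' : 'rV[R]_n -> R) x :
  convex_function [set: 'rV[R]_n] m' -> (forall y z, E y -> m' z <= h y z) ->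
  m' x <= comb_envelope E h x.
Proof.
move=> mc mh; apply: lb_le_inf.
  have [y Ey] := E0; exists (comb_value h [:: (1, (x, y))]).
  by exists [:: (1, (x, y))] => //; exact: convex_comb1.
by move=> _ [s xs <-]; exact: minorant_le_comb_value mc mh xs.
Qed.

Lemma comb_envelope_adherent x e : 0 < e ->
  exists2 s, convex_comb E x s & comb_value h s < comb_envelope E h x + e.
Proof.
move=> e0; have [|_ [s xs <-] se] := @inf_adherent R
    [set comb_value h s | s in convex_comb E x] e e0.
- split.
    have [y Ey] := E0; exists (comb_value h [:: (1, (x, y))]).
    by exists [:: (1, (x, y))] => //; exact: convex_comb1.
  exists (m x) => _ [s xs <-]; exact: minorant_le_comb_value m_convex m_le xs.
by exists s.
Qed.

(** Nearly optimal combinations for [x] and [y], with weights scaled by [t] and [1 - t], concatenate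
    to a combination for the intermediate point. *)
Lemma comb_envelope_convex :
  convex_function [set: 'rV[R]_n] (comb_envelope E h).
Proof.
apply/convex_function_setTP => x y t /andP[t0 t1].
apply/ler_addgt0Pr => e e0.
have [s [s0 s1 sx] se] := comb_envelope_adherent x e0.
have [s' [s0' s1' sy] se'] := comb_envelope_adherent y e0.
pose sc (c : R) (i : R * ('rV[R]_n * 'rV[R]_n)) := (c * i.1, i.2).
have t1' : 0 <= 1 - t by rewrite subr_ge0.
have xys : convex_comb E (t *: x + (1 - t) *: y)
    (map (sc t) s ++ map (sc (1 - t)) s').
  split.
  - move=> i; rewrite mem_cat => /orP[]/mapP[j js ->] /=.
      by have [? ?] := s0 j js; split=> //; exact: mulr_ge0.
    by have [? ?] := s0' j js; split=> //; exact: mulr_ge0.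
  - by rewrite big_cat !big_map -!mulr_sumr s1 s1' /=; ring.
  - rewrite big_cat !big_map -sx -sy !scaler_sumr.
    by congr (_ + _); apply: eq_bigr => i _; rewrite scalerA.
apply: le_trans (comb_envelope_le xys) _.
rewrite /comb_value big_cat !big_map /=.
have vE c r : \sum_(i <- r) c * i.1 * h i.2.2 i.2.1 = c * comb_value h r.
  by rewrite mulr_sumr; apply: eq_bigr => i _; rewrite mulrA.
rewrite !vE.
have := ler_wpM2l t0 (ltW se); have := ler_wpM2l t1' (ltW se'); lra.
Qed.

(** The left side is itself a convex minorant of the infimum, and by Jensen it lies above every
    other one. *)
Lemma comb_envelopeE x :
  (comb_envelope E h x)%:E =
  convex_envelope (fun z => ereal_inf [set (h y z)%:E | y in E]) x.
Proof.
apply/eqP; rewrite eq_le; apply/andP; split.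
  apply: ereal_sup_ubound; exists (comb_envelope E h) => //; split.
    exact: comb_envelope_convex.
  move=> z; apply: le_ereal_inf_tmp => _ [y Ey <-].
  by rewrite lee_fin; exact: comb_envelope_le_at.
apply: ge_ereal_sup => _ [m' [mc mh] <-]; rewrite lee_fin.
apply: comb_envelope_ge => // y z Ey; rewrite -lee_fin.
by apply: le_trans (mh z) _; apply: ereal_inf_lbound; exists y.
Qed.

Section semiconcave.
Context (p : 'rV[R]_n) (c a C0 : R).
Hypothesis c_gt0 : 0 < c.
Hypothesis a_gt0 : 0 < a.
Hypothesis h_coercive : forall x y, E y ->
  inner p x + c * enorm x - C0 + a * enorm (x - y) ^+ 2 <= h y x.
Hypothesis h_semiconcave : forall r, 0 < r -> exists2 M, 0 <= M &
  forall y x v, E y -> enorm y <= r -> enorm (x + v) <= r -> enorm (x - v) <= r ->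
    h y (x + v) + h y (x - v) - 2 * h y x <= M * enorm v ^+ 2.
Hypothesis env_bounded : forall r, 0 < r -> exists B, forall x, enorm x <= r ->
  comb_envelope E h x <= B.

Lemma comb_envelope_semiconcave r : 0 < r ->
  exists C, forall x u, enorm x <= r -> enorm u <= r ->
    comb_envelope E h (x + u) + comb_envelope E h (x - u)
      - 2 * comb_envelope E h x <= C * enorm u ^+ 2.
Proof.
move=> r0; have [B hB] := env_bounded r0.
(* [D] will bound the weighted mean of [w] over a combination that is optimal up to [e <= 1]. *)
pose D := `|B| + 1 + enorm p * r + `|C0|.
have D0 : 0 < D.
  have := mulr_ge0 (enorm_ge0 p) (ltW r0); have := normr_ge0 B.
  by have := normr_ge0 C0; rewrite /D; lra.
(* If [w i <= 2 D], the first term bounds [|x_i|], the second bounds [|x_i - y_i|] (from its square,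
   by [t <= t^2 + 1]), and [2 r] bounds the displacement. *)
pose r' := 2 * D / c + (2 * D / a + 1) + 2 * r.
have Dc0 : 0 < 2 * D / c by rewrite divr_gt0// mulr_gt0.
have Da0 : 0 < 2 * D / a by rewrite divr_gt0// mulr_gt0.
have r'0 : 0 < r' by rewrite /r'; lra.
have [M M0 hM] := h_semiconcave r'0.
exists (2 * M) => x u xr ur; apply: (@le_of_le_add_small _ _ _ 2 1) => //.
move=> e /andP[e0 e1].
have [s xs se] := comb_envelope_adherent x e0; have [s0 s1 sx] := xs.
pose w (i : R * ('rV[R]_n * 'rV[R]_n)) :=
  c * enorm i.2.1 + a * enorm (i.2.1 - i.2.2) ^+ 2.
pose b i : R := (w i <= 2 * D)%R%:R.
have w0 i : 0 <= w i.
  by rewrite addr_ge0// mulr_ge0 ?enorm_ge0 ?sqr_ge0 ?ltW.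
have sw : \sum_(i <- s) i.1 * w i <= D.
  apply: le_trans (_ : comb_value h s - inner p x + C0 <= _); last first.
    have := hB x xr; have := ler_norm B; have := ler_norm C0.
    have := cauchy_schwarz (- p) x; rewrite enormN.
    rewrite -scaleN1r innerZl mulN1r.
    by have := ler_wpM2l (enorm_ge0 p) xr; rewrite /D; lra.
  have -> : comb_value h s - inner p x + C0 =
      \sum_(i <- s) i.1 * (h i.2.2 i.2.1 - inner p i.2.1 + C0).
    have <- : \sum_(i <- s) i.1 * inner p i.2.1 = inner p x.
      rewrite -sx linear_sum; apply: eq_bigr => i _.
      by rewrite [RHS]innerZr.
    rewrite -[C0 in LHS]mul1r -s1 mulr_suml -sumrB -big_split.
    by apply: eq_bigr => i _ /=; ring.
  rewrite big_seq [leRHS]big_seq; apply: ler_sum => i /s0[i0 Ei].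
  by rewrite ler_wpM2l//; have := h_coercive i.2.1 Ei; rewrite /w; lra.
pose T := \sum_(i <- s) i.1 * b i.
(* Markov's inequality: the unselected indices have [w i > 2 D] while the mean of [w] is at most
   [D]. *)
have T2 : 2^-1 <= T.
  have : (1 - T) * (2 * D) <= D.
    apply: le_trans sw; rewrite -[X in X - T]s1 -sumrB mulr_suml.
    rewrite big_seq [leRHS]big_seq; apply: ler_sum => i /s0[i0 Ei].
    rewrite -[X in X - _]mulr1 -mulrBr -mulrA ler_wpM2l// /b.
    by have [_|/ltW] := leP (w i) (2 * D); rewrite ?subrr ?mul0r ?subr0 ?mul1r ?w0.
  by rewrite mulrA -[X in _ <= X -> _]mul1r ler_pM2r//; lra.
have T0 : 0 < T by apply: lt_le_trans T2; rewrite invr_gt0.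
have Tn0 : T != 0 by rewrite gt_eqF.
(* Only selected points move; as their total weight is [T], the factor [1 / T] makes the barycentre
   move by exactly [v]. *)
pose sh (v : 'rV[R]_n) (i : R * ('rV[R]_n * 'rV[R]_n)) :=
  (i.1, (i.2.1 + (b i / T) *: v, i.2.2)).
have comb_sh v : convex_comb E (x + v) (map (sh v) s).
  split.
  - by move=> _ /mapP[i si ->] /=; exact: s0.
  - by rewrite big_map.
  - rewrite big_map /=; under eq_bigr do rewrite scalerDr scalerA mulrA.
    by rewrite big_split -scaler_suml -mulr_suml sx divff// scale1r.
have := comb_envelope_le (comb_sh u); have := comb_envelope_le (comb_sh (- u)).
suff : comb_value h (map (sh u) s) + comb_value h (map (sh (- u)) s)
    - 2 * comb_value h s <= 2 * M * enorm u ^+ 2 by move: se; lra.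
rewrite /comb_value !big_map mulr_sumr -big_split -sumrB /=.
(* Unselected terms cancel. The others add up to [M |u|^2 / T], at most [2 M |u|^2] since
   [T >= 1/2]. *)
apply: le_trans (_ : \sum_(i <- s) i.1 * b i * (M * (T^-1 * enorm u) ^+ 2) <= _).
  rewrite big_seq [leRHS]big_seq; apply: ler_sum => i si.
  have [i0 Ei] := s0 i si; rewrite scalerN mulrCA -mulrDr -mulrBr -mulrA.
  rewrite ler_wpM2l// /b; have [wi|_] := leP (w i) (2 * D); last first.
    by rewrite mul0r scale0r subr0 addr0 mul0r; lra.
  rewrite !mul1r; set v := T^-1 *: u.
  have vE : enorm v = T^-1 * enorm u.
    by rewrite enormZ ger0_norm// invr_ge0 ltW.
  have xi : enorm i.2.1 <= 2 * D / c.
    rewrite ler_pdivlMr// mulrC; apply: le_trans wi; rewrite lerDl.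
    by rewrite mulr_ge0 ?sqr_ge0 ?ltW.
  have xyi : enorm (i.2.1 - i.2.2) <= 2 * D / a + 1.
    have : enorm (i.2.1 - i.2.2) ^+ 2 <= 2 * D / a.
      rewrite ler_pdivlMr// mulrC; apply: le_trans wi; rewrite lerDr.
      by rewrite mulr_ge0 ?enorm_ge0 ?ltW.
    have := sqr_ge0 (enorm (i.2.1 - i.2.2) - 1); have := enorm_ge0 (i.2.1 - i.2.2).
    nra.
  have vr : enorm v <= 2 * r.
    rewrite vE mulrC ler_pdivrMr//; apply: le_trans ur _.
    by rewrite mulrAC ler_peMl ?(ltW r0)//; lra.
  rewrite -vE; apply: hM => //.
  - rewrite -[i.2.2](subKr i.2.1); apply: le_trans (enormD _ _) _.
    by rewrite enormN /r'; lra.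
  - by apply: le_trans (enormD _ _) _; rewrite /r'; lra.
  - by apply: le_trans (enormD _ _) _; rewrite enormN /r'; lra.
rewrite -mulr_suml -/T.
have -> : T * (M * (T^-1 * enorm u) ^+ 2) = T^-1 * (M * enorm u ^+ 2) by field.
have T1 : T^-1 <= 2 by rewrite -div1r ler_pdivrMr//; lra.
by rewrite -mulrA ler_wpM2r// mulr_ge0// sqr_ge0.
Qed.

End semiconcave.
End comb_envelope_theory.

(** * The envelope of a jet *)

Section jet_envelope.
Context (R : realType) (n : nat) (E : set 'rV[R]_n).
Context (f : 'rV[R]_n -> R) (G : 'rV[R]_n -> 'rV[R]_n).
Context (phi : 'rV[R]_n -> 'rV[R]_n -> R) (a : R).
Hypothesis a_gt0 : 0 < a.
Hypothesis jet_phi : majorant_condition E f G phi.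

Let h (y x : 'rV[R]_n) : R :=
  f y + inner (G y) (x - y) + phi y x + a * enorm (x - y) ^+ 2.

Lemma tangent_le z y x : E z -> E y -> f z + inner (G z) (x - z) <= h y x.
Proof.
case: jet_phi => _ _ jetle Ez Ey; apply: le_trans (jetle y z x Ey Ez) _.
by rewrite lerDl mulr_ge0 ?sqr_ge0 ?ltW.
Qed.

(** Uniform in [y] because the supremum [M_r] also runs over [y]; the points [x + s v] and [x - s v]
    stay in the ball by convexity. *)
Lemma phi_second_difference r : 0 < r -> exists2 M, 0 <= M &
  forall y x v, E y -> enorm y <= r -> enorm (x + v) <= r -> enorm (x - v) <= r ->
    phi y (x + v) + phi y (x - v) - 2 * phi y x <= M * enorm v ^+ 2.
Proof.
case: jet_phi => phiC lip _ r0; have [M M0 hM] := grad_lip_bound (lip r r0).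
exists M => // y x v Ey yr xv xv'; have [[dphi _] _ _ _] := phiC y Ey.
apply: second_difference_le => // s /andP[s0 s1]; apply: hM => //.
  by apply: enorm_segment => //; lra.
by rewrite -scaleNr; apply: enorm_segment => //; lra.
Qed.

(** The affine part has zero second difference and the quadratic term contributes exactly
    [2 a |v|^2]. *)
Lemma h_second_difference r : 0 < r -> exists2 M, 0 <= M &
  forall y x v, E y -> enorm y <= r -> enorm (x + v) <= r -> enorm (x - v) <= r ->
    h y (x + v) + h y (x - v) - 2 * h y x <= M * enorm v ^+ 2.
Proof.
move=> /phi_second_difference[M M0 hM].
exists (M + 2 * a); first by rewrite addr_ge0// mulr_ge0// ltW.
move=> y x v Ey yr xv xv'; have := hM y x v Ey yr xv xv'.
rewrite /h !enorm_sqr !(innerBr, innerBl, innerDr, innerDl) (innerC v x).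
rewrite (innerC v y) (innerC y x); lra.
Qed.

(* [phi y >= 0] together with the bound on second differences at [y], where
   [phi y y = 0], bounds [phi y]. *)
Lemma h_bounded y r : E y -> 0 < r ->
  exists B, forall x, enorm x <= r -> h y x <= B.
Proof.
case: jet_phi => phiC _ _ Ey r0; have [_ phi0 phiy _] := phiC y Ey.
(* This radius accommodates [x], [y] and the reflection [2 y - x]. *)
have y0 := enorm_ge0 y; pose r' := 2 * enorm y + r.
have r'0 : 0 < r' by rewrite /r'; lra.
have [M M0 hM] := phi_second_difference r'0.
exists (f y + enorm (G y) * r' + (M + a) * r' ^+ 2) => x xr.
have xy : enorm (x - y) <= r'.
  by apply: le_trans (enormD _ _) _; rewrite enormN /r'; lra.
have xy2 : enorm (x - y) ^+ 2 <= r' ^+ 2.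
  by rewrite lerXn2r ?nnegrE ?enorm_ge0// ltW.
have yx : y + (x - y) = x by rewrite addrC subrK.
have := hM y y (x - y) Ey; rewrite yx phiy => hphi.
have : phi y x <= M * enorm (x - y) ^+ 2.
  have := phi0 (y - (x - y)).
  have /hphi : enorm y <= r' by rewrite /r'; lra.
  have xr' : enorm x <= r' by rewrite /r'; lra.
  move/(_ xr'); have : enorm (y - (x - y)) <= r'.
    apply: le_trans (enormD _ _) _; rewrite enormN.
    by have := enormD x (- y); rewrite enormN /r'; lra.
  by move=> yr /(_ yr); lra.
have := ler_wpM2l M0 xy2; have := ler_wpM2l (ltW a_gt0) xy2.
have := ler_wpM2l (enorm_ge0 (G y)) xy; have := cauchy_schwarz (G y) (x - y).
by rewrite /h; lra.
Qed.

Hypothesis E0 : E !=set0.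
Hypothesis spanE :
  lspan [set v | exists x y, [/\ E x, E y & v = G x - G y]] = [set: 'rV[R]_n].

(** At [y] in [E] the envelope is squeezed between the tangent at [y] and [h y], which both equal
    [f y] there. Coercivity is inherited from the tangents, with [inner p] as the linear
    function. *)
Lemma jet_envelope_extension :
  [/\ (forall x, (comb_envelope E h x)%:E =
         convex_envelope (inf_majorant E f G phi a) x),
      convex_C11_loc_extension E f G (comb_envelope E h) &
      essentially_coercive (comb_envelope E h)].
Proof.
have [z0 Ez0] := E0.
have mc z := affine_convex (G z) z (f z).
have mh z (Ez : E z) y x (Ey : E y) := tangent_le x Ez Ey.
have Fge z x (Ez : E z) := comb_envelope_ge E0 x (mc z) (mh z Ez).
have Fle y x (Ey : E y) := comb_envelope_le_at (mc z0) (mh z0 Ez0) x Ey.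
have Fc := comb_envelope_convex E0 (mc z0) (mh z0 Ez0).
have [p [c [C [c0 coer]]]] := tangents_coercive f E0 spanE.
have hcoer x y : E y ->
    inner p x + c * enorm x - C + a * enorm (x - y) ^+ 2 <= h y x.
  move=> Ey; have [z Ez zx] := coer x; case: jet_phi => _ _ jetle.
  by have := jetle y z x Ey Ez; rewrite /h; lra.
have Fsc := comb_envelope_semiconcave E0 (mc z0) (mh z0 Ez0) c0 a_gt0 hcoer
  h_second_difference.
have {}Fsc r : 0 < r -> exists C, forall x u, enorm x <= r -> enorm u <= r ->
    comb_envelope E h (x + u) + comb_envelope E h (x - u)
      - 2 * comb_envelope E h x <= C * enorm u ^+ 2.
  (* The envelope is bounded above on balls because it lies below the single function [h z0]. *)
  apply: Fsc => {}r r0; have [B hB] := h_bounded Ez0 r0.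
  by exists B => x /hB; apply: le_trans; exact: Fle.
have Ff y : E y -> comb_envelope E h y = f y.
  move=> Ey; apply/eqP; rewrite eq_le; apply/andP; split.
    apply: le_trans (Fle y y Ey) _; case: jet_phi => /(_ y Ey)[_ _ phiy _] _ _.
    by rewrite /h subrr inner0r phiy enorm0 expr0n mulr0 !addr0.
  by have := Fge y y Ey; rewrite subrr inner0r addr0.
split.
- by move=> x; rewrite (comb_envelopeE E0 (mc z0) (mh z0 Ez0)).
- split=> //; first exact: convex_semiconcave_C11_loc.
  move=> y Ey; pose r := enorm y + 1.
  have r0 : 0 < r by rewrite ltr_wpDl// enorm_ge0.
  have [K hK] := Fsc r r0.
  (* The tangent [G y] bounds the envelope from below at [y + u] and [y - u]; the latter bound and
     semiconcavity give the upper estimate at [y + u]. *)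
  have [] // := @differentiable_of_quadratic R n (comb_envelope E h) y (G y) K r r0.
  move=> u ur; have yr : enorm y <= r by rewrite lerDl.
  have sE v : y + v - y = v by rewrite addrAC subrr add0r.
  have := hK y u yr ur; have := Fge y (y + u) Ey; have := Fge y (y - u) Ey.
  by rewrite /= (Ff y Ey) !sE innerNr => h1 h2 h3; rewrite ger0_norm; lra.
- exists (inner p) => A; exists ((A + C) / c) => x.
  rewrite ler_pdivrMr// => Ax; have [z Ez zx] := coer x.
  by have := Fge z x Ez; rewrite mulrC in Ax; move: zx Ax => /=; lra.
Qed.

End jet_envelope.

Theorem theorem2p1 (R : realType) (n : nat) (E : set 'rV[R]_n)
    (f : 'rV[R]_n -> R) (G : 'rV[R]_n -> 'rV[R]_n) :
  E !=set0 ->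
  lspan [set v | exists x y, [/\ E x, E y & v = G x - G y]] = [set: 'rV[R]_n] ->
  [/\ (exists F : 'rV[R]_n -> R, convex_C11_loc_extension E f G F) <->
      (exists phi : 'rV[R]_n -> 'rV[R]_n -> R, majorant_condition E f G phi),
      (exists phi : 'rV[R]_n -> 'rV[R]_n -> R, majorant_condition E f G phi) ->
      exists F : 'rV[R]_n -> R,
        convex_C11_loc_extension E f G F /\ essentially_coercive F &
      forall phi : 'rV[R]_n -> 'rV[R]_n -> R, majorant_condition E f G phi ->
      forall a : R, 0 < a ->
      exists F : 'rV[R]_n -> R,
        [/\ (forall x, (F x)%:E = convex_envelope (inf_majorant E f G phi a) x),
            convex_C11_loc_extension E f G F &
            essentially_coercive F]].
Proof.
move=> E0 spanE; have env phi : majorant_condition E f G phi ->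
    forall a : R, 0 < a -> exists F : 'rV[R]_n -> R,
    [/\ (forall x, (F x)%:E = convex_envelope (inf_majorant E f G phi a) x),
        convex_C11_loc_extension E f G F & essentially_coercive F].
  move=> jet_phi a a0.
  by have := jet_envelope_extension a0 jet_phi E0 spanE; eexists; eauto.
split=> //; last first.
  by move=> [phi /env/(_ 1 ltr01)[F [_ extF coerF]]]; exists F.
split=> [[F extF]|[phi /env/(_ 1 ltr01)[F [_ extF _]]]]; last by exists F.
by eexists; exact: extension_majorant extF.
Qed.
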